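(* Let $\Sigma$ be a signed graph. Write its chromatic $B$-symmetric function $X_\Sigma$ as a polynomial with rational coefficients in the elements of the augmented elementary $B$-symmetric basis $\{e_n : n\ge 1\}\cup\{q_{a,b}: a,b\ge 1\}\cup\{z\}$. Then for every $k\ge 0$, the number of acyclic orientations of $\Sigma$ with exactly $k$ sinks equals the sum of the coefficients of those monomials that contain exactly $k$ factors of the form $e_n$ (counted with multiplicity).
   Context: A signed graph $\Sigma$ is a finite graph (loops and multiple edges allowed) together with a sign function $\mathrm{sgn}:E(\Sigma)\to\{+,-\}$; write $e:uv$ if $e$ has endpoints $u,v$ ($u=v$ for a loop). A coloring is a map $\kappa:V(\Sigma)\to\mathbb{Z}$; it is proper if $\kappa(u)\neq \mathrm{sgn}(e)\kappa(v)$ for every edge $e:uv$. The chromatic $B$-symmetric function is $X_\Sigma=\sum_{\kappa\text{ proper}}\prod_{v\in V(\Sigma)}x_{\kappa(v)}$, a formal power series in commuting variables $x_i$, $i\in\mathbb{Z}$. An orientation of $\Sigma$ assigns to each incidence of an edge with an endpoint (each half-edge; a loop has two) an arrow pointing toward or away from that vertex, such that on a positive edge exactly one of the two arrows points toward its vertex, and on a negative edge the two arrows either both point toward their vertices or both point away. A cycle is a closed walk such that, considering only the edges of the walk, every vertex of the walk has at least one arrow pointing into it and at least one pointing out of it; an orientation is acyclic if it has no cycle. A sink is a vertex all of whose incident arrows point toward it (an isolated vertex is a sink). Notation: $p_{a,b}=\sum_{i\in\mathbb{Z}}x_i^a x_{-i}^b$; $q_{a,b}=(-1)^{a+b+1}p_{a,b}$;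 $z=-x_0$; $e_n=\sum_{i_1<i_2<\dots<i_n,\ i_j\in\mathbb{Z}}x_{i_1}\cdots x_{i_n}$. The paper states that every chromatic $B$-symmetric function can be written uniquely as a polynomial in $\{e_n : n\ge1\}\cup\{q_{a,b}:a,b\ge1\}\cup\{z\}$. *)

(* Defs.v *)
From mathcomp Require Import all_boot all_order all_algebra.
From mathcomp Require Import mpoly.
Set Implicit Arguments. Unset Strict Implicit. Unset Printing Implicit Defensive.
Import Order.TTheory GRing.Theory Num.Theory.
Local Open Scope ring_scope.

Record signed_graph := SignedGraph {
  sg_V : finType;
  sg_E : finType;
  sg_ends : sg_E -> sg_V * sg_V;
  sg_pos : sg_E -> bool }.

Section SignedGraph.
Variable S : signed_graph.
Local Notation V := (sg_V S).
Local Notation E := (sg_E S).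

Definition esign (e : E) : int := if @sg_pos S e then 1 else -1.

(* half-edges: (e, false) is the incidence of e at its first endpoint,
   (e, true) the incidence at its second endpoint (a loop has two). *)
Definition hend (h : E * bool) : V :=
  if h.2 then (@sg_ends S h.1).2 else (@sg_ends S h.1).1.

(* An arrow assignment o on half-edges: o h = true iff the arrow of the
   half-edge h points toward its vertex.  It is an orientation iff on a
   positive edge exactly one arrow points toward its vertex, and on a
   negative edge both point toward or both point away. *)
Definition orientation (o : {ffun E * bool -> bool}) : bool :=
  [forall e : E, if @sg_pos S e then o (e, false) != o (e, true)
                 else o (e, false) == o (e, true)].

(* A closed walk v_0 e_0 v_1 e_1 ... v_{m-1} e_{m-1} v_0 (m >= 1) is
   encoded as the nonempty list w = [:: (v_0,e_0); ...; (v_{m-1},e_{m-1})]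
   where e_i joins v_i and v_{i+1} (indices mod m). *)
Definition joins (e : E) (u v : V) : bool :=
  (@sg_ends S e == (u, v)) || (@sg_ends S e == (v, u)).

Definition closed_walk (w : seq (V * E)) : bool :=
  (w != [::]) &&
  all (fun p : (V * E) * (V * E) => joins p.1.2 p.1.1 p.2.1) (zip w (rot 1 w)).

Definition is_cycle (o : {ffun E * bool -> bool}) (w : seq (V * E)) : bool :=
  closed_walk w &&
  all (fun v : V =>
         [exists h : E * bool, [&& h.1 \in map snd w, hend h == v & o h]] &&
         [exists h : E * bool, [&& h.1 \in map snd w, hend h == v & ~~ o h]])
      (map fst w).

Definition acyclic (o : {ffun E * bool -> bool}) : Prop :=
  forall w : seq (V * E), ~~ is_cycle o w.

(* a sink: every incident arrow points toward it (isolated => sink) *)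
Definition is_sink (o : {ffun E * bool -> bool}) (v : V) : bool :=
  [forall h : E * bool, (hend h == v) ==> o h].

Definition num_sinks (o : {ffun E * bool -> bool}) : nat :=
  #|[set v : V | is_sink o v]|.

(* Chromatic B-symmetric function.  A formal power series in the        *)
(* variables x_i (i in Z) is determined by its truncations to the       *)
(* variables x_{-N}, ..., x_N (set all other variables to 0; this is a  *)
(* ring morphism), for all N.  The truncation lives in                  *)
(* {mpoly rat[2N+1]}, variable 'X_j (j : 'I_(2N+1)) standing for        *)
(* x_{j - N}.                                                           *)
Definition toZ (N : nat) (j : 'I_(N.*2).+1) : int := (j : nat)%:Z - N%:Z.

Definition proper_col (N : nat) (k : {ffun V -> 'I_(N.*2).+1}) : bool :=
  [forall e : E, toZ (k (@sg_ends S e).1) != esign e * toZ (k (@sg_ends S e).2)].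

Definition XB (N : nat) : {mpoly rat[(N.*2).+1]} :=
  \sum_(k : {ffun V -> 'I_(N.*2).+1} | proper_col k) \prod_(v : V) 'X_(k v).

End SignedGraph.

Inductive gen := GenE of nat | GenQ of nat & nat | GenZ.

Definition gen_ok (g : gen) : bool :=
  match g with
  | GenE n => (1 <= n)%N
  | GenQ a b => (1 <= a)%N && (1 <= b)%N
  | GenZ => true
  end.

Definition is_genE (g : gen) : bool := if g is GenE _ then true else false.

(* p_{a,b} truncated: sum_{i=-N}^{N} x_i^a x_{-i}^b; index j <-> x_{j-N},
   and rev_ord j <-> x_{N-j} = x_{-(j-N)}. *)
Definition p_trunc (N a b : nat) : {mpoly rat[(N.*2).+1]} :=
  \sum_(j < (N.*2).+1) 'X_j ^+ a * 'X_(rev_ord j) ^+ b.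

Definition gen_trunc (N : nat) (g : gen) : {mpoly rat[(N.*2).+1]} :=
  match g with
  | GenE n => mesym (N.*2).+1 rat n
  | GenQ a b => (-1) ^+ (a + b + 1) * p_trunc N a b
  | GenZ => - 'X_(inord N)                                 (* z = -x_0 *)
  end.

(* A polynomial in the generators with rational coefficients, given as a
   list of terms (coefficient, monomial), a monomial being a list of
   generators (a multiset: order irrelevant, repetitions = powers). *)
Definition gpoly := seq (rat * seq gen).

Definition gpoly_ok (P : gpoly) : bool := all (fun t => all gen_ok t.2) P.

Definition gpoly_trunc (N : nat) (P : gpoly) : {mpoly rat[(N.*2).+1]} :=
  \sum_(t <- P) t.1 *: \prod_(g <- t.2) gen_trunc N g.

Definition coef_sum_E (P : gpoly) (k : nat) : rat :=
  \sum_(t <- P | count is_genE t.2 == k) t.1.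

(* Main.v *)
Require Import Defs.
From mathcomp Require Import all_boot all_order all_algebra.
From mathcomp Require Import mpoly.
From mathcomp Require Import zify ring.
Local Open Scope ring_scope.

(** Evaluate the identity at x_0 = -1, x_i = x_(-i) = -1 for 1 <= i <= m,
    x_(m+1) = t - 1, x_(-m-1) = 0. Both sides become polynomials in m, which may
    be continued to m = -1; there e_n becomes t while q_(a,b) and z become 1, so
    the polynomial P becomes the sum of coef * t^(number of e-factors).

    On the chromatic side, colour m + 1 selects a set U of future sinks, weighted
    (t - 1)^|U|, and leaves (-1)^|V - U| times the number of proper colourings of
    the rest by [-m, m]. At m = -1 the latter is the number of acyclic orientations
    of the rest, i.e. of acyclic orientations of the whole graph in which every
    vertex of U is a sink; summing over U gives the sum of t^(number of sinks).

    The reciprocity at m = -1 follows from removing the vertices coloured m or -m.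
    Continued to m = 0 this recursion expresses the colourings with the single
    colour 0 through the values at -1. It is satisfied by acyclic orientations
    because choosing vertices to be sinks (A) or sources (B), with sign
    (-1)^(|A| + |B|), cancels at every non-isolated sink or source, and an acyclic
    orientation of a graph with an edge has such a vertex. *)

Import Order.TTheory GRing.Theory Num.Theory.
Set Implicit Arguments.
Unset Strict Implicit.
Unset Printing Implicit Defensive.

(** * Continuation to -1 of polynomial functions on the naturals *)

Lemma coef_X1_exp (R : nzRingType) (n i : nat) :
  (('X + 1) ^+ n : {poly R})`_i = ('C(n, i))%:R.
Proof.
have -> : ('X + 1) ^+ n = \poly_(j < n.+1) ('C(n, j))%:R :> {poly R}.
  by rewrite exprD1n poly_def; apply: eq_bigr => j _; rewrite scaler_nat.
rewrite coef_poly; case: ltnP => // lt_ni.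
by rewrite bin_small.
Qed.

(** Induction on the degree of [D]: the difference of X^(n+1) has leading term (n+1) X^n, so a
    multiple of X^(n+1) accounts for the top coefficient. *)
Lemma antidifference (D : {poly rat}) :
  exists G : {poly rat}, forall x, G.[x + 1] = G.[x] + D.[x].
Proof.
suff [G defG] : exists G : {poly rat}, G \Po ('X + 1) = G + D.
  exists G => x; rewrite -hornerD -defG horner_comp.
  by rewrite hornerD hornerX hornerC.
move: {2}(size D) (leqnn (size D)) => n; elim: n D => [|n IHn] D leDn.
  exists 0; rewrite comp_poly0 add0r; apply/esym/eqP.
  by rewrite -size_poly_leq0.
pose Q : {poly rat} := (D`_n / n.+1%:R) *: 'X^(n.+1).
pose dQ := Q \Po ('X + 1) - Q.
have dQE i : dQ`_i = (D`_n / n.+1%:R) * (('C(n.+1, i))%:R - (i == n.+1)%:R).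
  rewrite coefB comp_polyZ comp_Xn_poly !coefZ coef_X1_exp coefXn.
  by rewrite mulrBr.
have [|G defG] := IHn (D - dQ).
  apply/leq_sizeP => j; rewrite leq_eqVlt coefB dQE => /predU1P[<-|lt_nj].
    rewrite binSn ltn_eqF // subr0 divfK ?subrr //.
    by rewrite pnatr_eq0.
  have -> : D`_j = 0 by move/leq_sizeP: leDn; apply.
  move: lt_nj; rewrite leq_eqVlt => /predU1P[<-|lt_nj].
    by rewrite eqxx binn subrr mulr0 subrr.
  by rewrite bin_small // gtn_eqF // subrr mulr0 subrr.
exists (G + Q); rewrite comp_polyD defG.
have -> : Q \Po ('X + 1) = dQ + Q by rewrite subrK.
by ring.
Qed.

Lemma poly_eq_on_nat (p q : {poly rat}) :
  (forall n : nat, p.[n%:R] = q.[n%:R]) -> p = q.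
Proof.
move=> pq; apply/eqP; rewrite -subr_eq0; apply/eqP.
pose r := p - q; pose s : seq rat := [seq i%:R | i <- iota 0 (size r)].
apply: (@roots_geq_poly_eq0 _ r s); last by rewrite size_map size_iota.
  by apply/allP => _ /mapP[i _ ->]; rewrite rootE hornerD hornerN pq subrr.
by rewrite map_inj_uniq ?iota_uniq // => i j /eqP; rewrite eqr_nat => /eqP.
Qed.

(** A relation, so that no polynomial has to be carried along; [a] is determined because a
    polynomial is fixed by its values on the naturals. *)
Definition value_at_m1 (f : nat -> rat) (a : rat) :=
  exists2 p : {poly rat}, forall m, p.[m%:R] = f m & p.[-1] = a.

Lemma value_at_m1_unique f a b :
  value_at_m1 f a -> value_at_m1 f b -> a = b.
Proof.
move=> [p pf <-] [q qf <-]; congr _.[_].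
by apply: poly_eq_on_nat => n; rewrite pf qf.
Qed.

Lemma value_at_m1_ext f g a :
  f =1 g -> value_at_m1 f a -> value_at_m1 g a.
Proof. by move=> fg [p pf pa]; exists p => // m; rewrite pf. Qed.

Lemma value_at_m1_const c : value_at_m1 (fun=> c) c.
Proof. by exists c%:P => [m|]; rewrite hornerC. Qed.

Lemma value_at_m1_id : value_at_m1 (fun m => m%:R) (-1).
Proof. by exists 'X => [m|]; rewrite hornerX. Qed.

Lemma value_at_m1D f g a b :
  value_at_m1 f a -> value_at_m1 g b ->
  value_at_m1 (fun m => f m + g m) (a + b).
Proof.
by move=> [p pf <-] [q qg <-]; exists (p + q) => [m|]; rewrite hornerD ?pf ?qg.
Qed.

Lemma value_at_m1M f g a b :
  value_at_m1 f a -> value_at_m1 g b ->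
  value_at_m1 (fun m => f m * g m) (a * b).
Proof.
by move=> [p pf <-] [q qg <-]; exists (p * q) => [m|]; rewrite hornerM ?pf ?qg.
Qed.

Lemma value_at_m1_sum (I : Type) (r : seq I) (Q : pred I) f a :
  (forall i, Q i -> value_at_m1 (f i) (a i)) ->
  value_at_m1 (fun m => \sum_(i <- r | Q i) f i m) (\sum_(i <- r | Q i) a i).
Proof.
move=> fa; elim: r => [|i r IHr].
  rewrite big_nil; apply: value_at_m1_ext (value_at_m1_const 0) => m.
  by rewrite big_nil.
rewrite big_cons; case: ifP => Qi.
  apply: value_at_m1_ext (value_at_m1D (fa i Qi) IHr) => m.
  by rewrite big_cons Qi.
by apply: value_at_m1_ext IHr => m; rewrite big_cons Qi.
Qed.

(** An antidifference of the polynomial of [d] differs from [f] by a constant, and from -1 to 0 it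
    grows by [b]. *)
Lemma value_at_m1_diff f d b :
  (forall m, f m.+1 = f m + d m) -> value_at_m1 d b ->
  value_at_m1 f (f 0%N - b).
Proof.
move=> fS [D Dd Db]; have [G GS] := antidifference D.
exists (G + (f 0%N - G.[0])%:P) => [m|].
  rewrite hornerD hornerC; elim: m => [|m IHm]; first by rewrite addrC subrK.
  by rewrite -natr1 GS Dd fS -IHm addrAC.
have := GS (-1); rewrite addNr hornerD hornerC Db => ->; ring.
Qed.

(** The continued value is the binomial coefficient of -1 over [n], computed through the falling
    factorial, whose factors are linear in [m]. *)
Lemma value_at_m1_bin n :
  value_at_m1 (fun m => ('C(m.*2.+1, n))%:R) ((-1) ^+ n).
Proof.
have n_fact : n`!%:R != 0 :> rat by rewrite pnatr_eq0 -lt0n fact_gt0.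
suff /value_at_m1M/(_ (value_at_m1_const (n`!%:R)^-1)) :
    value_at_m1 (fun m => (m.*2.+1 ^_ n)%:R) ((-1) ^+ n * n`!%:R).
  rewrite mulfK //; apply: value_at_m1_ext => m.
  by rewrite -bin_ffact natrM mulfK.
elim: n {n_fact} => [|n IHn].
  rewrite mulr1; apply: value_at_m1_ext (value_at_m1_const 1) => m.
  by rewrite ffactn0.
have linear : value_at_m1 (fun m => m%:R * 2 + (1 - n%:R)) (- n.+1%:R).
  suff -> : - n.+1%:R = -1 * 2 + (1 - n%:R) :> rat.
    by apply: value_at_m1D (value_at_m1M value_at_m1_id _) _;
       apply: value_at_m1_const.
  by rewrite -natr1; ring.
suff -> : (-1) ^+ n.+1 * n.+1`!%:R = (-1) ^+ n * n`!%:R * - n.+1%:R :> rat.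
  apply: value_at_m1_ext (value_at_m1M IHn linear) => m.
  (* For [m.*2.+1 < n] the subtraction on naturals truncates, but the falling factorial is already
     0. *)
  rewrite ffactnSr natrM; have [lt_mn|le_nm] := ltnP m.*2.+1 n.
    by rewrite ffact_small // !mul0r.
  by rewrite natrB // -muln2 -[(m * 2).+1%:R]natr1 natrM; ring.
by rewrite factS natrM exprS; ring.
Qed.

(** * Acyclic orientations *)

Section Induced.
Variable S : signed_graph.
Local Notation V := (sg_V S).
Local Notation E := (sg_E S).
Local Notation orient := {ffun E * bool -> bool}.
Implicit Types (W : {set V}) (o : orient) (c : {ffun V -> option bool}).

Definition edges_in W : {set E} :=
  [set e | (hend (e, false) \in W) && (hend (e, true) \in W)].

Lemma edges_inP W e : reflect (forall b, hend (e, b) \in W) (e \in edges_in W).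
Proof.
rewrite inE; apply: (iffP andP) => [[We We'] [] //|We].
by rewrite !We.
Qed.

(* [x] and [y] are the arrows at the two ends of an edge of sign [p]. *)
Definition coherent (p x y : bool) := if p then x != y else x == y.

Lemma coherentC p x y : coherent p x y = coherent p y x.
Proof. by case: p x y => [] [] []. Qed.

(* Values outside [edges_in W] are normalised to [false], so that each orientation of
   the subgraph induced by [W] is counted once. *)
Definition orientation_in W o :=
  [forall e, if e \in edges_in W
             then coherent (sg_pos e) (o (e, false)) (o (e, true))
             else ~~ o (e, false) && ~~ o (e, true)].

(** Absence of cycles, phrased with edge sets instead of walks to be decidable: the edges of a cycle
    would form a set without sink or source. The link to walks is [acyclicE]. *)
Definition acyclic_on (F0 : {set E}) o :=
  [forall F : {set E}, (F \subset F0) && (F != set0) ==>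
    [exists h : E * bool, (h.1 \in F) &&
      [forall h' : E * bool,
         (h'.1 \in F) && (hend h' == hend h) ==> (o h' == o h)]]].

Lemma acyclic_onP (F0 : {set E}) o :
  reflect (forall F : {set E}, F \subset F0 -> F != set0 ->
             exists2 h : E * bool, h.1 \in F &
               forall h', h'.1 \in F -> hend h' = hend h -> o h' = o h)
          (acyclic_on F0 o).
Proof.
apply: (iffP forallP) => [ac F sF nzF|ac F]; last first.
  apply/implyP => /andP[sF nzF]; have [h Fh hP] := ac F sF nzF.
  apply/existsP; exists h; rewrite Fh; apply/forallP => h'.
  by apply/implyP => /andP[Fh' /eqP h'h]; rewrite hP.
have /implyP := ac F; rewrite sF nzF => /(_ isT) /existsP[h /andP[Fh /forallP hP]].
exists h => // h' Fh' h'h; have /implyP := hP h'.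
by rewrite Fh' h'h eqxx => /(_ isT) /eqP.
Qed.

Definition acyclic_orientations W : {set orient} :=
  [set o | orientation_in W o && acyclic_on (edges_in W) o].

Lemma orientation_in_coherent W o h : orientation_in W o ->
  h.1 \in edges_in W -> coherent (sg_pos h.1) (o h) (o (h.1, ~~ h.2)).
Proof.
case: h => e b /forallP/(_ e) /=; case: ifP => // _ oe _.
by case: b => //=; rewrite coherentC.
Qed.

Lemma orientation_in_out W o h : orientation_in W o ->
  h.1 \notin edges_in W -> o h = false.
Proof.
case: h => e b /forallP/(_ e) /=; case: ifP => // _ /andP[/negbTE oe /negbTE oe'] _.
by case: b.
Qed.

(* [c] selects vertices to become sinks ([Some true]) or sources
   ([Some false]); equally, vertices receiving the top colour or its negative. *)
Definition selectable W c :=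
  [forall v, c v ==> (v \in W)] &&
  [forall e, match c (hend (e, false)), c (hend (e, true)) with
             | Some x, Some y => coherent (sg_pos e) x y
             | _, _ => true
             end].

Definition unselected W c : {set V} := [set v in W | c v == None].

(** An isolated vertex of [W] qualifies both as a sink and as a source. *)
Definition compatible_at W o v (x : option bool) :=
  if x is Some a
  then (v \in W) && [forall h : E * bool,
         (hend h == v) && (h.1 \in edges_in W) ==> (o h == a)]
  else true.

Definition compatible W c o := [forall v, compatible_at W o v (c v)].

Lemma compatible_atP W o v a :
  reflect (v \in W /\
           forall h, hend h = v -> h.1 \in edges_in W -> o h = a)
          (compatible_at W o v (Some a)).
Proof.
apply: (iffP andP) => -[Wv hP]; split => //.
  move=> h hv Wh; have /implyP := forallP hP h.
  by rewrite hv eqxx Wh => /(_ isT) /eqP.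
by apply/forallP => h; apply/implyP => /andP[/eqP hv Wh]; rewrite (hP h).
Qed.

Lemma selectable_in W c v a : selectable W c -> c v = Some a -> v \in W.
Proof. by case/andP=> /forallP/(_ v)/implyP cW _ cv; rewrite cW ?cv. Qed.

Lemma selectable_coherent W c h x y : selectable W c ->
  c (hend h) = Some x -> c (hend (h.1, ~~ h.2)) = Some y ->
  coherent (sg_pos h.1) x y.
Proof.
case: h => e b /andP[_ /forallP/(_ e)]; case: b => /=.
  by move=> ce cx cy; move: ce; rewrite cx cy coherentC.
by move=> ce cx cy; move: ce; rewrite cx cy.
Qed.

Lemma compatible_selectable W c o :
  orientation_in W o -> compatible W c o -> selectable W c.
Proof.
move=> oW /forallP co.
have cE v a : c v = Some a -> compatible_at W o v (Some a).
  by move=> cv; rewrite -cv.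
apply/andP; split; apply/forallP.
  move=> v; apply/implyP; case cv: (c v) => [a|] // _.
  by have /compatible_atP[] := cE _ _ cv.
move=> e; case cx: (c _) => [x|] //; case cy: (c _) => [y|] //.
have /compatible_atP[Wx xP] := cE _ _ cx.
have /compatible_atP[Wy yP] := cE _ _ cy.
have We : e \in edges_in W by rewrite inE Wx Wy.
have := @orientation_in_coherent W o (e, false) oW We.
by rewrite (xP (e, false)) // (yP (e, true)).
Qed.

(** * Compatible orientations and orientations of the unselected part *)

Lemma edges_in_unselected W c e : e \in edges_in (unselected W c) =
  [&& e \in edges_in W, c (hend (e, false)) == None & c (hend (e, true)) == None].
Proof.
rewrite !inE; case: (_ \in W) => //=; case: (_ \in W) => //=.
by rewrite andbF.
Qed.

Lemma edges_in_unselectedP W c e :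
  reflect (e \in edges_in W /\ forall b, c (hend (e, b)) = None)
          (e \in edges_in (unselected W c)).
Proof.
rewrite edges_in_unselected; apply: (iffP and3P) => [[We /eqP c0 /eqP c1]|[We ce]].
  by split=> // -[].
by rewrite !ce.
Qed.

(** The only candidate for a compatible extension: a selected end dictates its own arrow, and the
    sign of the edge then dictates the arrow at an unselected other end. *)
Definition extend_selected W c o : orient :=
  [ffun h : E * bool => (h.1 \in edges_in W) &&
    match c (hend h), c (hend (h.1, ~~ h.2)) with
    | Some a, _ => a
    | None, Some a => if sg_pos h.1 then ~~ a else a
    | None, None => o h
    end].

Definition restrict_unselected W c o : orient :=
  [ffun h : E * bool => (h.1 \in edges_in (unselected W c)) && o h].

Lemma extend_selectedK W c o :
  o \in acyclic_orientations W -> compatible W c o ->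
  extend_selected W c (restrict_unselected W c o) = o.
Proof.
rewrite inE => /andP[oW _] /forallP co; apply/ffunP => h; rewrite !ffunE.
have cE v a : c v = Some a -> compatible_at W o v (Some a).
  by move=> cv; rewrite -cv.
have [Wh|Wh] := boolP (h.1 \in edges_in W); last by rewrite (orientation_in_out oW).
case cx: (c (hend h)) => [x|] /=.
  by have /compatible_atP[_ ->] := cE _ _ cx.
have ho := orientation_in_coherent oW Wh.
case cy: (c _) => [y|] /=.
  have /compatible_atP[_ yP] := cE _ _ cy.
  move: ho; rewrite (yP (h.1, ~~ h.2)) // /coherent.
  by case: (sg_pos _); case: (o h); case: y {cy yP}.
rewrite (_ : h.1 \in _) //; apply/edges_in_unselectedP; split=> // b.
by case: h {Wh ho} cx cy => e [] /=; case: b.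
Qed.

Lemma extend_selected_in W c o h : h.1 \in edges_in (unselected W c) ->
  extend_selected W c o h = o h.
Proof.
move=> /edges_in_unselectedP[Wh ch]; rewrite ffunE Wh ch /=.
by case: h Wh ch => e b Wh ch; rewrite ch.
Qed.

Lemma restrict_unselectedK W c o : orientation_in (unselected W c) o ->
  restrict_unselected W c (extend_selected W c o) = o.
Proof.
move=> oW; apply/ffunP => h; rewrite ffunE.
have [Wh|Wh] := boolP (h.1 \in _); last by rewrite (orientation_in_out oW).
by rewrite extend_selected_in.
Qed.

Lemma extend_selected_compatible W c o :
  selectable W c -> compatible W c (extend_selected W c o).
Proof.
move=> cW; apply/forallP => v; case cv: (c v) => [a|] //.
apply/compatible_atP; split; first exact: selectable_in cv.
by move=> h hv Wh; rewrite ffunE Wh hv cv.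
Qed.

Lemma edges_in_unselected_sub W c :
  edges_in (unselected W c) \subset edges_in W.
Proof. by apply/subsetP => e /edges_in_unselectedP[]. Qed.

Lemma extend_selected_acyclic W c o : selectable W c ->
  o \in acyclic_orientations (unselected W c) ->
  extend_selected W c o \in acyclic_orientations W.
Proof.
move=> cW; rewrite !inE => /andP[oW /acyclic_onP ac]; apply/andP; split.
  apply/forallP => e; case: ifPn => We; last by rewrite !ffunE /= (negbTE We).
  rewrite !ffunE /= We /=; have := @selectable_coherent W c (e, false) _ _ cW.
  case cx: (c (hend (e, false))) => [x|]; case cy: (c (hend (e, true))) => [y|] /=.
  - exact.
  - by move=> _; rewrite /coherent; case: (sg_pos e); case: x {cx}.
  - by move=> _; rewrite /coherent; case: (sg_pos e); case: y {cy}.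
  move=> _; apply: (@orientation_in_coherent _ o (e, false) oW).
  by apply/edges_in_unselectedP; split=> // -[].
apply/acyclic_onP => F sF nzF.
(* Either [F] lies in the unselected part, where [o] is acyclic, or one of its edges has a selected
   end, and there all arrows agree. *)
have [sF'|/subsetPn[e Fe]] := boolP (F \subset edges_in (unselected W c)).
  have [h Fh hP] := ac F sF' nzF; exists h => // h' Fh' h'h.
  by rewrite !extend_selected_in ?(subsetP sF') ?hP.
have We := subsetP sF e Fe.
rewrite edges_in_unselected We /= negb_and => ce.
have [b ceb] : exists b, c (hend (e, b)) != None.
  by case/orP: ce => ce; [exists false | exists true].
exists (e, b) => // h' Fh' h'h; rewrite !ffunE We (subsetP sF) // h'h.
by case: (c _) ceb.
Qed.

Lemma restrict_unselected_acyclic W c o :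
  o \in acyclic_orientations W ->
  restrict_unselected W c o \in acyclic_orientations (unselected W c).
Proof.
rewrite !inE => /andP[oW /acyclic_onP ac].
have rE h : h.1 \in edges_in (unselected W c) -> restrict_unselected W c o h = o h.
  by move=> Wh; rewrite ffunE Wh.
apply/andP; split.
  apply/forallP => e; case: ifPn => We; last by rewrite !ffunE /= (negbTE We).
  rewrite !rE //; apply: (@orientation_in_coherent _ o (e, false) oW).
  exact: subsetP (edges_in_unselected_sub _ _) _ We.
apply/acyclic_onP => F sF nzF.
have [|h Fh hP] := ac F _ nzF.
  exact: subset_trans sF (edges_in_unselected_sub _ _).
by exists h => // h' Fh' h'h; rewrite !rE ?(subsetP sF) ?hP.
Qed.

Lemma card_compatible W c :
  #|[set o in acyclic_orientations W | compatible W c o]| =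
  if selectable W c then #|acyclic_orientations (unselected W c)| else 0%N.
Proof.
case: ifPn => cW; last first.
  apply: eq_card0 => o; rewrite inE; apply/negP => /andP[].
  rewrite inE => /andP[oW _] /(compatible_selectable oW).
  by rewrite (negbTE cW).
have inj : {in acyclic_orientations (unselected W c) &, injective (extend_selected W c)}.
  move=> o o'; rewrite !inE => /andP[oW _] /andP[oW' _] oo'.
  by rewrite -(restrict_unselectedK oW) oo' restrict_unselectedK.
rewrite -(card_in_imset inj); apply: eq_card => o; rewrite inE.
apply/andP/imsetP => [[oW co]|[o' oW' ->]].
  exists (restrict_unselected W c o); first exact: restrict_unselected_acyclic.
  by rewrite extend_selectedK.
split; first exact: extend_selected_acyclic.
exact: extend_selected_compatible.
Qed.

(** Double counting of pairs of a selection and a compatible orientation: for a fixed orientation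
    the vertices are selected independently, so the sum factors. *)
Lemma sum_selectable W (w : option bool -> rat) :
  \sum_(c | selectable W c)
     (\prod_v w (c v)) * #|acyclic_orientations (unselected W c)|%:R =
  \sum_(o in acyclic_orientations W)
     \prod_v \sum_(x | compatible_at W o v x) w x.
Proof.
transitivity (\sum_c \sum_(o in acyclic_orientations W | compatible W c o)
                \prod_v w (c v)).
  rewrite big_mkcond; apply: eq_bigr => c _ /=.
  rewrite (eq_bigl (mem [set o in acyclic_orientations W | compatible W c o]));
    last by move=> o; rewrite /= [RHS]in_set.
  rewrite sumr_const card_compatible; case: ifP; rewrite ?mulr0n //.
  by rewrite mulr_natr.
rewrite (exchange_big_dep (mem (acyclic_orientations W))) /=; last first.
  by move=> c o _ /andP[].
apply: eq_bigr => o oW; rewrite (bigA_distr_big_dep (compatible_at W o)).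
apply: eq_bigl => c; rewrite oW.
by apply/forallP/familyP => co v; apply: co.
Qed.

(** The test is for [Some], not for the boolean inside: sinks and sources both get -1. *)
Definition sgn_sel (x : option bool) : rat := if x then -1 else 1.

Lemma big_option_bool (Q : pred (option bool)) (w : option bool -> rat) :
  \sum_(x | Q x) w x = (if Q None then w None else 0)
    + (if Q (Some true) then w (Some true) else 0)
    + (if Q (Some false) then w (Some false) else 0).
Proof.
rewrite big_mkcond (bigD1 None) //= (bigD1 (Some true)) //=.
rewrite (bigD1 (Some false)) //= big1 ?addr0 ?addrA //.
by case=> [[]|].
Qed.

(** A non-isolated sink or source contributes the factor 1 - 1 = 0, and acyclicity provides such a
    vertex as soon as there is an edge. *)
Lemma sum_selectable_sgn W :
  \sum_(c | selectable W c)
     (\prod_v sgn_sel (c v)) * #|acyclic_orientations (unselected W c)|%:R =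
  if edges_in W == set0 then (-1) ^+ #|W| else 0.
Proof.
rewrite sum_selectable; case: ifPn => [/eqP W0|nzW]; last first.
  apply: big1 => o; rewrite inE => /andP[oW /acyclic_onP ac].
  have [[e b] /= Wh hP] := ac _ (subxx _) nzW.
  rewrite (bigD1 (hend (e, b))) //= big_option_bool /=.
  have cE a : compatible_at W o (hend (e, b)) (Some a) = (o (e, b) == a).
    apply/compatible_atP/eqP => [[_]|<-]; first exact.
    split; first exact: (edges_inP _ _ Wh).
    by move=> h' h'h Wh'; apply: hP.
  move: (cE true) (cE false) => /= -> ->.
  by case: (o _) => /=; rewrite ?addr0 subrr ?addr0 mul0r.
pose o0 : orient := [ffun=> false].
have -> : acyclic_orientations W = [set o0].
  apply/setP => o; rewrite !inE; apply/andP/eqP => [[oW _]|->].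
    by apply/ffunP => h; rewrite ffunE (orientation_in_out oW) // W0 inE.
  split; first by apply/forallP => e; rewrite W0 inE !ffunE.
  apply/acyclic_onP => F; rewrite W0 subset0 => /eqP->.
  by rewrite eqxx.
rewrite big_set1 -prodr_const [RHS]big_mkcond; apply: eq_bigr => v _.
(* Without edges every vertex of [W] admits all three choices, hence the factor 1 - 1 - 1 = -1. *)
have cE a : compatible_at W o0 v (Some a) = (v \in W).
  apply/compatible_atP/idP => [[]//|Wv]; split=> // h _.
  by rewrite W0 inE.
rewrite big_option_bool (cE true) (cE false) /=.
by case: ifP; rewrite ?addr0 // subrr add0r.
Qed.

(** * Proper colorings and reciprocity *)

(** (-1)^|W| times the number of proper colourings of the induced subgraph by [-m, m], organised by
    the vertices of colour m or -m. *)
Fixpoint signed_colorings m W : rat :=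
  if m is m'.+1 then
    \sum_(c | selectable W c)
      (\prod_v sgn_sel (c v)) * signed_colorings m' (unselected W c)
  else if edges_in W == set0 then (-1) ^+ #|W| else 0.

Lemma selectable_none W : selectable W [ffun=> None].
Proof.
by apply/andP; split; apply/forallP => ?; rewrite ffunE.
Qed.

Lemma unselected_none W : unselected W [ffun=> None] = W.
Proof. by apply/setP => v; rewrite inE ffunE andbT. Qed.

Lemma card_unselected W c : selectable W c -> c != [ffun=> None] ->
  (#|unselected W c| < #|W|)%N.
Proof.
move=> cW c_neq; apply: proper_card; apply/properP; split.
  by apply/subsetP => v; rewrite inE => /andP[].
have [v cv] : exists v, c v != None.
  apply/existsP; apply: contraNT c_neq; rewrite negb_exists => /forallP c0.
  by apply/eqP/ffunP => v; rewrite ffunE; apply/eqP; have := c0 v; rewrite negbK.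
exists v; last by rewrite inE (negbTE cv) andbF.
by case cvE: (c v) cv => [a|] // _; apply: selectable_in cvE.
Qed.

(* Zaslavsky's analogue of Stanley's reciprocity for the chromatic polynomial. *)
Lemma signed_colorings_at_m1 W :
  value_at_m1 (signed_colorings^~ W) #|acyclic_orientations W|%:R.
Proof.
move: {2}(#|W|).+1 (ltnSn #|W|) => n; elim: n W => [|n IHn] W // leWn.
(* The empty selection returns [W] itself, so the other selections make up the forward difference;
   they leave fewer vertices. *)
pose d m := \sum_(c | selectable W c && (c != [ffun=> None]))
  (\prod_v sgn_sel (c v)) * signed_colorings m (unselected W c).
pose b : rat := \sum_(c | selectable W c && (c != [ffun=> None]))
  (\prod_v sgn_sel (c v)) * #|acyclic_orientations (unselected W c)|%:R.
have sgn0 : \prod_(v : V) sgn_sel ([ffun=> None] v) = 1.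
  by apply: big1 => v _; rewrite ffunE.
have -> : #|acyclic_orientations W|%:R = signed_colorings 0 W - b.
  rewrite /= -sum_selectable_sgn (bigD1 [ffun=> None]) ?selectable_none //=.
  by rewrite sgn0 unselected_none mul1r addrK.
apply: (@value_at_m1_diff _ d).
  move=> m; rewrite /= (bigD1 [ffun=> None]) ?selectable_none //=.
  by rewrite sgn0 unselected_none mul1r.
apply: value_at_m1_sum => c /andP[cW c_neq].
apply: value_at_m1M; first exact: value_at_m1_const.
by apply: IHn; apply: leq_trans (card_unselected cW c_neq) _.
Qed.

(** * Weighted colourings and removal of the top level *)

Section Colorings.
Variable N : nat.
Variable y : 'I_(N.*2).+1 -> rat.
Implicit Types k : {ffun V -> 'I_(N.*2).+1}.

(** Index [i] stands for the colour [i - N], so opposite colours have indices with sum [N.*2]. *)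
Definition clash (p : bool) (i j : nat) := if p then i == j else (i + j == N.*2)%N.

Lemma toZ_clash (e : E) (i j : 'I_(N.*2).+1) :
  (toZ i == esign e * toZ j) = clash (sg_pos e) i j.
Proof. rewrite /toZ /esign /clash; case: (sg_pos e); lia. Qed.

(* Colour [j - N] has level [`|j - N|]; vertices outside [W] get colour 0. *)
Definition coloring_in W m k :=
  [forall v, if v \in W then (N - m <= k v <= N + m)%N else k v == N :> nat] &&
  [forall e, (e \in edges_in W) ==>
     ~~ clash (sg_pos e) (k (hend (e, false))) (k (hend (e, true)))].

Definition weighted_colorings W m :=
  \sum_(k | coloring_in W m k) \prod_(v in W) y (k v).

Lemma XB_weighted_colorings : (XB S N).@[y] = weighted_colorings [set: V] N.
Proof.
rewrite /XB raddf_sum /=; apply: eq_big => [k|k _].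
  apply/forallP/andP => [kP|[_ /forallP kP] e].
    split; apply/forallP.
      by move=> v; rewrite inE; have := ltn_ord (k v); lia.
    move=> e; apply/implyP => _; have := kP e.
    by rewrite toZ_clash.
  by have := kP e; rewrite !inE toZ_clash.
rewrite rmorph_prod /=; apply: eq_big => [v|v _]; first by rewrite inE.
by rewrite mevalXU.
Qed.

(** Only colour 0 is left; being its own negative, it clashes along edges of either sign. *)
Lemma weighted_colorings0 W :
  weighted_colorings W 0 = if edges_in W == set0 then y (inord N) ^+ #|W| else 0.
Proof.
have inordN : (inord N : 'I_(N.*2).+1) = N :> nat by rewrite inordK //; lia.
pose k0 : {ffun V -> 'I_(N.*2).+1} := [ffun=> inord N].
have kE k : coloring_in W 0 k = (k == k0) && (edges_in W == set0).
  apply/andP/andP => [[/forallP kP /forallP eP]|[/eqP -> /eqP W0]].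
    have kN v : k v = N :> nat by have := kP v; case: ifP => _; lia.
    split; first by apply/eqP/ffunP => v; rewrite ffunE; apply/val_inj; rewrite /= kN inordN.
    apply: contraT => /set0Pn[e We]; have := eP e; rewrite We !kN /clash.
    by case: ifP; lia.
  split; apply/forallP; last by move=> e; rewrite W0 inE.
  by move=> v; rewrite ffunE inordN; case: ifP; lia.
rewrite /weighted_colorings (eq_bigl _ _ kE).
case: ifP => _; last by rewrite big_pred0 // => k; rewrite andbF.
rewrite (eq_bigl (pred1 k0)); last by move=> k; rewrite andbT.
rewrite big_pred1_eq -prodr_const.
by apply: eq_bigr => v _; rewrite ffunE.
Qed.

Definition top_color m (a : bool) : 'I_(N.*2).+1 :=
  if a then inord (N + m) else inord (N - m).

Arguments top_color : simpl never.

Definition top_weight m (x : option bool) :=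
  if x is Some a then y (top_color m a) else 1.

Definition selection W m k : {ffun V -> option bool} :=
  [ffun v => if v \in W then
     if k v == top_color m true then Some true
     else if k v == top_color m false then Some false else None else None].

Definition paint m c k : {ffun V -> 'I_(N.*2).+1} :=
  [ffun v => if c v is Some a then top_color m a else k v].

(** Selected vertices return to colour 0, the value that [coloring_in] prescribes outside its vertex
    set. *)
Definition unpaint c k : {ffun V -> 'I_(N.*2).+1} :=
  [ffun v => if c v then inord N else k v].

(** Colourings are sorted by the vertices of colour m+1 or -m-1. Adjacent ones avoid a clash exactly
    when the selection is coherent, and these colours never clash with colours of smaller absolute
    value. *)
Lemma weighted_coloringsS W m : (m < N)%N ->
  weighted_colorings W m.+1 =
  \sum_(c | selectable W c)
    (\prod_v top_weight m.+1 (c v)) * weighted_colorings (unselected W c) m.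
Proof.
move=> lt_mN.
have inordN : (inord N : 'I_(N.*2).+1) = N :> nat by rewrite inordK //; lia.
have topE a : top_color m.+1 a = (if a then N + m.+1 else N - m.+1)%N :> nat.
  by rewrite /top_color; case: a; rewrite inordK //; lia.
have selE k v : (selection W m.+1 k v = None) <->
    (v \in W -> k v != N + m.+1 :> nat /\ k v != N - m.+1 :> nat)%N.
  rewrite ffunE -!val_eqE /= !topE; case: ifP => _ //.
  split=> [|/(_ isT)[/negbTE-> /negbTE->]] //.
  by case: eqP => // _; case: eqP.
have selS k v a : selection W m.+1 k v = Some a -> k v = top_color m.+1 a.
  by rewrite ffunE; case: ifP => // _; case: eqP => [-> [<-]|_] //; case: eqP => [-> [<-]|].
rewrite /weighted_colorings (partition_big (selection W m.+1) (selectable W)) /=; last first.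
  move=> k /andP[/forallP kP /forallP eP]; apply/andP; split; apply/forallP.
    by move=> v; rewrite ffunE; case: ifP; rewrite ?implybT.
  move=> e; case c0: (selection _ _ _ _) => [a|] //.
  case c1: (selection _ _ _ _) => [b|] //.
  have We : e \in edges_in W.
    apply/edges_inP => -[]; [move: c1|move: c0]; rewrite ffunE; by case: ifP.
  have := eP e; rewrite We /= (selS _ _ _ c0) (selS _ _ _ c1) !topE /clash /coherent.
  by case: (sg_pos e); case: a {c0}; case: b {c1} => //=; lia.
apply: eq_bigr => c cW.
rewrite (reindex_onto (paint m.+1 c) (unpaint c)) /=; last first.
  move=> k /andP[_ /eqP defc]; apply/ffunP => v; rewrite !ffunE.
  by case cv: (c v) => [a|] //; rewrite (selS k v a) // defc.
rewrite mulr_sumr; apply: eq_big => [k|k _]; last first.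
  rewrite [X in X = _]big_mkcond [X in _ * X]big_mkcond -big_split /=.
  apply: eq_bigr => v _; rewrite inE ffunE.
  case cv: (c v) => [a|] /=; last by rewrite andbT mul1r.
  by rewrite (selectable_in cW cv) mulr1.
apply/andP/andP => [[/andP[/andP[/forallP kP /forallP eP] /eqP defc] /eqP upk]|].
  have pE v : c v = None -> paint m.+1 c k v = k v by rewrite ffunE => ->.
  split; apply/forallP.
    move=> v; rewrite inE; case cv: (c v) => [a|].
      by rewrite andbF -upk ffunE cv inordN.
    rewrite andbT; have := kP v; rewrite (pE _ cv); case: ifP => // Wv.
    have /selE/(_ Wv) : selection W m.+1 (paint m.+1 c k) v = None by rewrite defc.
    by rewrite pE //; lia.
  move=> e; apply/implyP => /edges_in_unselectedP[We ce].
  by have := eP e; rewrite We !pE.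
case=> /forallP kP /forallP eP.
have pS v a : c v = Some a -> paint m.+1 c k v = top_color m.+1 a by rewrite ffunE => ->.
have pE v : c v = None -> paint m.+1 c k v = k v by rewrite ffunE => ->.
have kN v : c v = None -> v \in W -> (N - m <= k v <= N + m)%N.
  by move=> cv Wv; have := kP v; rewrite inE Wv cv.
split; last first.
  apply/eqP/ffunP => v; rewrite !ffunE; case cv: (c v) => [a|] //=.
  have := kP v; rewrite inE cv andbF => /eqP kv.
  by apply/val_inj; rewrite /= kv inordN.
apply/andP; split; last first.
  apply/eqP/ffunP => v; case cv: (c v) => [a|].
    rewrite ffunE (selectable_in cW cv) (pS v a cv) -!val_eqE /= !topE.
    by case: a {cv}; rewrite ?eqxx // ifF ?eqxx //; lia.
  by apply/selE => Wv; rewrite pE //; have := kN _ cv Wv; lia.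
apply/andP; split; apply/forallP.
  move=> v; case cv: (c v) => [a|].
    by rewrite (selectable_in cW cv) (pS v a cv) topE; case: a {cv}; lia.
  rewrite pE //; case: ifP => Wv; first by have := kN _ cv Wv; lia.
  by have := kP v; rewrite inE Wv.
move=> e; apply/implyP => We.
have W0 := edges_inP _ _ We false; have W1 := edges_inP _ _ We true.
case c0: (c (hend (e, false))) => [a|]; case c1: (c (hend (e, true))) => [b|].
- have := @selectable_coherent W c (e, false) a b cW c0 c1.
  rewrite (pS _ _ c0) (pS _ _ c1) !topE /clash /coherent /=.
  by case: (sg_pos e); case: a {c0}; case: b {c1} => //=; lia.
- rewrite (pS _ _ c0) (pE _ c1) topE /clash; have := kN _ c1 W1.
  by case: (sg_pos e); case: a {c0} => //=; lia.
- rewrite (pS _ _ c1) (pE _ c0) topE /clash; have := kN _ c0 W0.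
  by case: (sg_pos e); case: b {c1} => //=; lia.
rewrite !pE //; have := eP e; rewrite edges_in_unselected We c0 c1 /=.
exact.
Qed.

Lemma weighted_colorings_m1 W m :
  (forall j : 'I_(N.*2).+1, (N - m <= j <= N + m)%N -> y j = -1) ->
  (m <= N)%N -> weighted_colorings W m = signed_colorings m W.
Proof.
elim: m W => [|m IHm] W y1 lemN.
  rewrite weighted_colorings0 y1 //= inordK //; lia.
rewrite weighted_coloringsS //=; apply: eq_bigr => c _; congr (_ * _).
  apply: eq_bigr => v _; case: (c v) => [[]|] //=; apply: y1;
    rewrite inordK; lia.
by apply: IHm; [move=> j jP; apply: y1|]; lia.
Qed.

End Colorings.

(** * Cycles as closed walks *)

Definition walk_step (p q : V * E) := joins p.2 p.1 q.1.

Lemma joinsP (e : E) u v :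
  reflect (exists b, u = hend (e, b) /\ v = hend (e, ~~ b)) (joins e u v).
Proof.
rewrite /joins; case def_e: (sg_ends e) => [x y].
apply: (iffP orP) => [[/eqP[<- <-]|/eqP[<- <-]]|[[] []]].
- by exists false; rewrite /hend /= def_e.
- by exists true; rewrite /hend /= def_e.
- by rewrite /hend /= def_e /= => -> ->; right.
- by rewrite /hend /= def_e /= => -> ->; left.
Qed.

Lemma closed_walkE (w : seq (V * E)) :
  closed_walk w = (w != [::]) && cycle walk_step w.
Proof.
case: w => // x s; rewrite /closed_walk rot1_cons /cycle.
suff pathE a z : all (fun p : (V * E) * (V * E) => joins p.1.2 p.1.1 p.2.1)
    (zip (a :: s) (rcons s z)) = path walk_step a (rcons s z) by rewrite pathE.
by elim: s a => [|b s IHs] a //=; rewrite IHs.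
Qed.

Lemma walk_vertex (w : seq (V * E)) e b : cycle walk_step w ->
  e \in map snd w -> hend (e, b) \in map fst w.
Proof.
move=> cw /mapP[[v e'] we /= def_e']; rewrite -{}def_e' in we.
have /joinsP[b' /= [vE nE]] := next_cycle cw we.
have [->|] := eqVneq b b'; first by rewrite -vE; apply: (map_f fst we).
move=> bb'; have -> : b = ~~ b' by case: b b' bb' {vE nE} => [] [].
by rewrite -nE; apply: map_f; rewrite mem_next.
Qed.

(** A cycle yields an edge set without sink or source. Conversely, inside such a set a closed walk
    is enlarged until it uses all edges of the set at its vertices; it is then a cycle. *)
Lemma acyclicE o : acyclic o <-> acyclic_on [set: E] o.
Proof.
split=> [ac|/acyclic_onP ac w]; last first.
  apply/negP => /andP[]; rewrite closed_walkE => /andP[nzw cw] /allP wP.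
  pose F := [set e | e \in map snd w].
  have nzF : F != set0.
    by case: w nzw @F {cw wP} => // p w _; apply/set0Pn; exists p.2; rewrite inE mem_head.
  have [[e b] Fh hP] := ac F (subsetT _) nzF.
  have /wP : hend (e, b) \in map fst w by apply: walk_vertex cw _; rewrite inE in Fh.
  case/andP => /existsP[h1 /and3P[w1 /eqP h1v o1]] /existsP[h2 /and3P[w2 /eqP h2v o2]].
  by move: o1 o2; rewrite (hP h1) ?inE // (hP h2) ?inE // => ->.
apply: contraPT ac => /forallPn[F]; rewrite negb_imply => /andP[/andP[_ nzF]].
rewrite negb_exists => /forallP badF.
have bad h : h.1 \in F -> exists h', [/\ h'.1 \in F, hend h' = hend h & o h' != o h].
  move=> Fh; have := badF h; rewrite Fh => /forallPn[h'].
  by rewrite negb_imply => /andP[/andP[Fh' /eqP h'h] oh']; exists h'.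
suff [w cyc_w] : exists w, is_cycle o w by move=> /(_ w); rewrite cyc_w.
have [e0 Fe0] := set0Pn _ nzF.
pose w0 := [:: (hend (e0, false), e0); (hend (e0, true), e0)].
have cw0 : cycle walk_step w0.
  rewrite /= /walk_step /=; apply/and3P; split=> //.
    by apply/joinsP; exists false.
  by apply/joinsP; exists true.
have nzw0 : w0 != [::] by [].
have sw0 : {subset map snd w0 <= F} by move=> e; rewrite !inE orbb => /eqP->.
(* A closed walk in [F] that misses an edge of [F] at one of its vertices is
   enlarged by traversing that edge back and forth. *)
have [n] := ubnP (#|F| - #|[set e in map snd w0]|)%N.
elim: n w0 cw0 nzw0 sw0 => [|n IHn] w cw nzw sw //; rewrite ltnS => le_n.
have [/existsP[h /and3P[wv Fh wh]]|/existsPn no_h] := boolP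
    [exists h : E * bool, [&& hend h \in map fst w, h.1 \in F & h.1 \notin map snd w]].
  have [[v e] we /= vE] := mapP wv.
  have [i s def_w] := rot_to we.
  (* The walk, rotated to start at [v], is preceded by a detour along [h.1] and back. *)
  pose w' := [:: (v, h.1), (hend (h.1, ~~ h.2), h.1), (v, e) & s].
  have hw' : map snd w' =i h.1 :: map snd w.
    move=> e1; rewrite /w' /= !inE orbA orbb; congr (_ || _).
    by rewrite -(mem_rot i (map snd w)) -map_rot def_w.
  apply: (IHn w') => //.
  - move: cw; rewrite -(rot_cycle i) def_w /= !rcons_path.
    have step q b : hend (h.1, b) = q.1 -> walk_step (hend (h.1, ~~ b), h.1) q.
      by rewrite /walk_step => <-; apply/joinsP; exists (~~ b); rewrite negbK.
    have hE : h = (h.1, h.2) by case: (h).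
    move=> /andP[pw lw]; apply/and3P; split.
    + by apply/joinsP; exists h.2; rewrite -hE.
    + by apply: step; rewrite -hE.
    by rewrite pw.
  - by move=> e1; rewrite hw' inE => /predU1P[->|/sw].
  apply: leq_trans le_n.
  have -> : [set e1 in map snd w'] = h.1 |: [set e1 in map snd w].
    by apply/setP => e1; rewrite in_setU1 !in_set hw' in_cons.
  have /subset_leq_card : h.1 |: [set e1 in map snd w] \subset F.
    by apply/subsetP => e1; rewrite !inE => /predU1P[->|/sw].
  by rewrite cardsU1 inE wh /=; lia.
exists w; rewrite /is_cycle closed_walkE nzw cw /=; apply/allP => v wv.
have memw h : hend h = v -> h.1 \in F -> h.1 \in map snd w.
  by move=> hv Fh; have := no_h h; rewrite hv wv Fh /= negbK.
have [[u e] we /= vE] := mapP wv.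
have we2 : e \in map snd w := map_f snd we.
have /joinsP[b /= [uE _]] := next_cycle cw we.
have [h' [Fh' h'v oh']] := bad (e, b) (sw _ we2).
have h'v' : hend h' = v by rewrite h'v vE uE.
have ebv : hend (e, b) == v by rewrite vE uE.
have wh' := memw _ h'v' Fh'.
(* The half-edges [(e, b)] and [h'] at [v] carry opposite arrows, and both edges lie on the walk. *)
case ob: (o (e, b)) oh' => oh'; apply/andP; split; apply/existsP.
- by exists (e, b); rewrite we2 ebv ob.
- by exists h'; rewrite wh' h'v' eqxx; case: (o h') oh'.
- by exists h'; rewrite wh' h'v' eqxx; case: (o h') oh'.
by exists (e, b); rewrite we2 ebv ob.
Qed.

Lemma acyclic_orientationsP o :
  reflect (orientation o /\ acyclic o) (o \in acyclic_orientations [set: V]).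
Proof.
have ET : edges_in [set: V] = [set: E] by apply/setP => e; rewrite !inE.
rewrite inE ET; have -> : orientation_in [set: V] o = orientation o.
  by apply: eq_forallb => e; rewrite ET inE.
by apply: (iffP andP) => -[oT ac]; split=> //; apply/acyclicE.
Qed.

(** Sources have weight 0, so a sink contributes 1 + (t - 1) = t and any other vertex 1. *)
Lemma sum_sinks (t : rat) :
  \sum_(c | selectable [set: V] c)
     (\prod_v (if c v is Some a then if a then t - 1 else 0 else 1))
       * #|acyclic_orientations (unselected [set: V] c)|%:R =
  \sum_(o in acyclic_orientations [set: V]) t ^+ num_sinks o.
Proof.
rewrite (sum_selectable [set: V]
  (fun x => if x is Some a then if a then t - 1 else 0 else 1)).
apply: eq_bigr => o _; rewrite -prodr_const [RHS]big_mkcond; apply: eq_bigr => v _.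
rewrite big_option_bool (_ : compatible_at _ _ _ (Some true) = is_sink o v).
  by rewrite if_same addr0 inE; case: ifP => _; rewrite ?addr0 // addrC subrK.
apply/compatible_atP/forallP => [[_ oP] h|oP]; first by apply/implyP => /eqP/oP->; rewrite ?inE.
split=> // h hv _.
by have := oP h; rewrite hv eqxx.
Qed.

(** * The chromatic side at the specialization point *)

Section Specialization.
Variable t : rat.

(* Level N gets (t - 1, 0) and all lower levels -1: continued to N = 0, this sends
   every e_n to t, and every q_{a,b} and z to 1. *)
Definition spec_point N (j : 'I_(N.*2).+1) : rat :=
  if j == ord_max then t - 1 else if j == ord0 then 0 else -1.

(** Removing level m+1 leaves colourings with all weights -1, to which reciprocity applies. *)
Lemma XB_at_m1 :
  value_at_m1 (fun m => (XB S m.+1).@[@spec_point m.+1])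
    (\sum_(o in acyclic_orientations [set: V]) t ^+ num_sinks o).
Proof.
rewrite -sum_sinks.
pose f m := \sum_(c | selectable [set: V] c)
     (\prod_v (if c v is Some a then if a then t - 1 else 0 else 1))
       * signed_colorings m (unselected [set: V] c).
apply: (@value_at_m1_ext f) => [m|]; last first.
  apply: value_at_m1_sum => c _; apply: value_at_m1M.
    exact: value_at_m1_const.
  exact: signed_colorings_at_m1.
rewrite XB_weighted_colorings weighted_coloringsS //; apply: eq_bigr => c _.
congr (_ * _); last first.
  rewrite weighted_colorings_m1 // => j jP.
  by rewrite /spec_point -!val_eqE /= !ifF //; lia.
apply: eq_bigr => v _; rewrite /top_weight; case: (c v) => // a.
by rewrite /spec_point /top_color -!val_eqE /=; case: a; rewrite inordK ?addnn ?eqxx ?subnn //=; lia.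
Qed.

End Specialization.

End Induced.

(** * Specialization of the generators *)

Lemma mesym_generating (n : nat) (R : comNzRingType) (y : 'I_n -> R) k :
  (mesym n R k).@[y] = (\prod_i (y i *: 'X + 1) : {poly R})`_k.
Proof.
rewrite bigA_distr coef_sum raddf_sum /= big_mkcond /=.
apply: eq_bigr => J _; rewrite rmorph_prod /= -big_mkcond /=.
have -> : \prod_(i in J) (y i *: 'X) = (\prod_(i in J) y i) *: 'X^#|J| :> {poly R}.
  by rewrite scaler_prod prodr_const.
rewrite coefZ coefXn eq_sym; case: ifP => _; rewrite ?mulr0 // mulr1.
by apply: eq_bigr => i _; rewrite mevalXU.
Qed.

Lemma coef_subX1_exp (R : nzRingType) (n i : nat) :
  ((- 'X + 1) ^+ n : {poly R})`_i = (-1) ^+ i * ('C(n, i))%:R.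
Proof.
have -> : (- 'X + 1) ^+ n = \poly_(j < n.+1) ((-1) ^+ j * ('C(n, j))%:R) :> {poly R}.
  rewrite exprD1n poly_def; apply: eq_bigr => j _.
  rewrite (exprNn 'X) -!(signr_odd _ j); case: (odd j).
    by rewrite !expr1 !mulN1r scaleNr scaler_nat mulNrn.
  by rewrite !expr0 !mul1r scaler_nat.
rewrite coef_poly; case: ltnP => // lt_ni.
by rewrite bin_small ?mulr0.
Qed.

Lemma big_ord_ends (R : Type) (idx : R) (op : Monoid.law idx) n
    (F : 'I_n.+2 -> R) x :
  (forall j : 'I_n.+2, (0 < j < n.+1)%N -> F j = x) ->
  \big[op/idx]_j F j = op (op (F ord0) (\big[op/idx]_(j < n) x)) (F ord_max).
Proof.
move=> Fx; rewrite big_ord_recr big_ord_recl /=; congr (op (op (F _) _) (F _)).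
  exact: val_inj.
apply: eq_bigr => j _; apply: Fx.
by have := ltn_ord j; rewrite /= /bump; lia.
Qed.

Section Generators.
Variable t : rat.

Lemma spec_point_max N : @spec_point t N ord_max = t - 1.
Proof. by rewrite /spec_point eqxx. Qed.

Lemma spec_point_min N : (0 < N)%N -> @spec_point t N ord0 = 0.
Proof. by move=> N_gt0; rewrite /spec_point eqxx ifF // -val_eqE /=; lia. Qed.

Lemma spec_point_mid N (j : 'I_(N.*2).+1) :
  (0 < j < N.*2)%N -> @spec_point t N j = -1.
Proof. by move=> jP; rewrite /spec_point -!val_eqE /= !ifF //; lia. Qed.

Lemma big_spec_point (R : Type) (idx : R) (op : Monoid.law idx) m
    (F : 'I_(m.+1.*2).+1 -> R) x :
  (forall j : 'I_(m.+1.*2).+1, (0 < j < m.+1.*2)%N -> F j = x) ->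
  \big[op/idx]_j F j =
  op (op (F ord0) (\big[op/idx]_(j < m.*2.+1) x)) (F ord_max).
Proof. exact: big_ord_ends. Qed.

(** The generating product is (1 + (t - 1) X) (1 - X)^(2m+1), and each coefficient of its second
    factor continues to 1, giving (t - 1) + 1. *)
Lemma mesym_at_m1 n :
  value_at_m1 (fun m => (mesym (m.+1.*2).+1 rat n.+1).@[@spec_point t m.+1]) t.
Proof.
pose a k m : rat := (-1) ^+ k * ('C(m.*2.+1, k))%:R.
have a1 k : value_at_m1 (a k) 1.
  rewrite -[1](signrMK k) mulr1.
  by apply: value_at_m1M (value_at_m1_bin k); apply: value_at_m1_const.
rewrite -[X in value_at_m1 _ X](subrK 1) -[t - 1 in X in value_at_m1 _ X]mulr1.
apply: value_at_m1_ext (value_at_m1D (value_at_m1M (value_at_m1_const (t - 1)) (a1 n)) (a1 n.+1)) => m.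
rewrite mesym_generating (@big_spec_point _ _ _ _ _ (- 'X + 1)); last first.
  by move=> j jP; rewrite spec_point_mid // scaleN1r.
rewrite spec_point_max spec_point_min // scale0r add0r /= mul1r.
rewrite prodr_const card_ord mulrDr mulr1 -scalerAr.
by rewrite coefD coefZ coefMX !coef_subX1_exp.
Qed.

(** As [a] and [b] are positive, both extreme terms contain x_(-m-1) = 0. The 2m+1 others equal
    (-1)^(a+b), so the total is -(2m+1). *)
Lemma p_trunc_at_m1 a b : (0 < a)%N -> (0 < b)%N ->
  value_at_m1 (fun m => ((-1) ^+ (a + b + 1) * p_trunc m.+1 a b).@[@spec_point t m.+1]) 1.
Proof.
move=> a_gt0 b_gt0.
have -> : 1 = -1 * (-1 * 2 + 1) :> rat by [].
apply: value_at_m1_ext (value_at_m1M (value_at_m1_const (-1))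
  (value_at_m1D (value_at_m1M value_at_m1_id (value_at_m1_const 2)) (value_at_m1_const 1))) => m.
rewrite mevalM rmorphXn rmorphN rmorph1 /p_trunc raddf_sum /=.
rewrite (@big_spec_point _ _ _ _ _ ((-1) ^+ (a + b))); last first.
  move=> j jP; rewrite mevalM !rmorphXn /= !mevalXU !spec_point_mid ?exprD //=.
  by lia.
have rev0 : rev_ord ord_max = ord0 :> 'I_(m.+1.*2).+1 by apply: val_inj; rewrite /= subnn.
have revm : rev_ord ord0 = ord_max :> 'I_(m.+1.*2).+1 by apply: val_inj; rewrite /= subn1.
rewrite !mevalM !rmorphXn /= !mevalXU rev0 revm spec_point_min //.
rewrite !expr0n !gtn_eqF //= mul0r mulr0 addr0 add0r.
rewrite sumr_const card_ord addn1 exprS -mulrA; congr (_ * _).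
by rewrite [RHS]mulrnAr -expr2 sqrr_sign -[in RHS]natr1 -muln2 natrM.
Qed.

Lemma gen_at_m1 g : gen_ok g ->
  value_at_m1 (fun m => (gen_trunc m.+1 g).@[@spec_point t m.+1])
    (if is_genE g then t else 1).
Proof.
case: g => [[|n]|a b|] //=.
- by move=> _; apply: mesym_at_m1.
- by case/andP; apply: p_trunc_at_m1.
move=> _; apply: value_at_m1_ext (value_at_m1_const 1) => m.
rewrite mevalN mevalXU spec_point_mid ?opprK // inordK; lia.
Qed.

Lemma monomial_at_m1 (u : seq gen) : all gen_ok u ->
  value_at_m1 (fun m => (\prod_(g <- u) gen_trunc m.+1 g).@[@spec_point t m.+1])
    (t ^+ count is_genE u).
Proof.
elim: u => [_|g u IHu /= /andP[ok_g /IHu u1]].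
  apply: value_at_m1_ext (value_at_m1_const 1) => m.
  by rewrite big_nil rmorph1.
have -> : t ^+ (is_genE g + count is_genE u) =
    (if is_genE g then t else 1) * t ^+ count is_genE u.
  by case: (is_genE g); rewrite ?mul1r // exprS.
apply: value_at_m1_ext (value_at_m1M (gen_at_m1 ok_g) u1) => m.
by rewrite big_cons mevalM.
Qed.

Lemma gpoly_at_m1 P : gpoly_ok P ->
  value_at_m1 (fun m => (gpoly_trunc m.+1 P).@[@spec_point t m.+1])
    (\sum_(u <- P) u.1 * t ^+ count is_genE u.2).
Proof.
elim: P => [_|[x u] P IHP /= /andP[/monomial_at_m1 u1 /IHP P1]].
  rewrite big_nil; apply: value_at_m1_ext (value_at_m1_const 0) => m.
  by rewrite /gpoly_trunc big_nil rmorph0.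
rewrite big_cons.
apply: value_at_m1_ext (value_at_m1D (value_at_m1M (value_at_m1_const x) u1) P1) => m.
by rewrite /gpoly_trunc big_cons mevalD mevalZ.
Qed.

End Generators.

(** * Comparison of the coefficients of t^k *)

Theorem theorem3p1 (S : signed_graph) (P : gpoly) :
  gpoly_ok P ->
  (forall N : nat, gpoly_trunc N P = XB S N) ->
  forall k : nat,
  exists A : {set {ffun sg_E S * bool -> bool}},
    (forall o, o \in A <-> [/\ orientation o, acyclic o & num_sinks o = k]) /\
    (#|A|%:R = coef_sum_E P k :> rat).
Proof.
move=> okP PX k.
exists [set o in acyclic_orientations [set: sg_V S] | num_sinks o == k]; split.
  move=> o; rewrite in_set; split=> [/andP[/acyclic_orientationsP[oT ac] /eqP ok]|[oT ac ok]].
    by split.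
  by rewrite ok eqxx andbT; apply/acyclic_orientationsP.
(* Both continuations are polynomials in t; they agree at every natural t, hence coefficientwise. *)
pose Q1 : {poly rat} := \sum_(o in acyclic_orientations [set: sg_V S]) 'X^(num_sinks o).
pose Q2 : {poly rat} := \sum_(u <- P) u.1 *: 'X^(count is_genE u.2).
have Q12 : Q1 = Q2.
  apply: poly_eq_on_nat => n.
  transitivity (\sum_(o in acyclic_orientations [set: sg_V S]) n%:R ^+ num_sinks o : rat).
    by rewrite horner_sum; apply: eq_bigr => o _; rewrite hornerXn.
  transitivity (\sum_(u <- P) u.1 * n%:R ^+ count is_genE u.2 : rat); last first.
    by rewrite horner_sum; apply: eq_bigr => o _; rewrite hornerZ hornerXn.
  apply: value_at_m1_unique (XB_at_m1 S n%:R) _.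
  by apply: value_at_m1_ext (gpoly_at_m1 n%:R okP) => m; rewrite PX.
have Q12k : Q1`_k = Q2`_k by rewrite Q12.
rewrite !coef_sum in Q12k; rewrite /coef_sum_E [RHS]big_mkcond /=.
transitivity (\sum_(u <- P) (u.1 *: 'X^(count is_genE u.2) : {poly rat})`_k); last first.
  by apply: eq_bigr => u _; rewrite coefZ coefXn eq_sym; case: ifP; rewrite ?mulr1 ?mulr0.
rewrite -Q12k -sum1_card natr_sum (eq_bigl (fun o =>
    (o \in acyclic_orientations [set: sg_V S]) && (num_sinks o == k))); last first.
  by move=> o; rewrite in_set.
rewrite big_mkcondr /=; apply: eq_bigr => o _.
by rewrite coefXn eq_sym; case: ifP.
Qed.
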